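(* Let $K\ge1$ and let $\mathcal{P}$ be the nonparametric model for $O=(X,A,\overline{Z}_K,\overline{M}_K,Y)$ described in the context, with the functionals $\tau_k,\Delta_k,\pi_k,\eta_k,\theta_k$ of the law $P\in\mathcal{P}$ defined there. Let $\mathbb{IF}(\cdot)$ denote the efficient influence function (EIF) of a functional under $\mathcal{P}$. Then for every $k\in\{1,\dots,K\}$ the EIFs of $\eta_k$ and $\theta_k$ are $$\mathbb{IF}(\eta_k)=\mathbb{IF}(\tau_{k-1})-\mathbb{IF}(\Delta_{k-1})-\tau_k\,\mathbb{IF}(\pi_k)-\pi_k\,\mathbb{IF}(\tau_k),$$ $$\mathbb{IF}(\theta_k)=\mathbb{IF}(\Delta_k)\prod_{j=1}^{k}\pi_j+\Delta_k\sum_{j=1}^{k}\mathbb{IF}(\pi_j)\prod_{\substack{l=1\\ l\ne j}}^{k}\pi_l+\mathbb{IF}(\eta_k)\prod_{j=1}^{k-1}\pi_j+\eta_k\sum_{j=1}^{k-1}\mathbb{IF}(\pi_j)\prod_{\substack{l=1\\ l\neq j}}^{k-1}\pi_l .$$ Moreover, the corresponding EIF-based estimators (obtained by setting the empirical mean of the estimated EIF equal to zero and solving for $\eta_k$, respectively $\theta_k$) are $$\hat\eta_k^{\mathrm{eif}}=\mathbb{P}_n\Big[\widehat{\mathbb{RIF}}(\tau_{k-1})-\widehat{\mathbb{RIF}}(\Delta_{k-1})-\hat\tau_k\widehat{\mathbb{RIF}}(\pi_k)-\hat\pi_k\widehat{\mathbb{RIF}}(\tau_k)+\hat\pi_k\hat\tau_k\Big],$$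 $$\hat\theta_k^{\mathrm{eif}}=\mathbb{P}_n\Big[\widehat{\mathbb{RIF}}(\Delta_k)\prod_{j=1}^{k}\hat\pi_j+\hat\Delta_k\sum_{j=1}^{k}\widehat{\mathbb{RIF}}(\pi_j)\prod_{\substack{l=1\\ l\ne j}}^{k}\hat\pi_l+\widehat{\mathbb{RIF}}(\eta_k)\prod_{j=1}^{k-1}\hat\pi_j+\hat\eta_k\sum_{j=1}^{k-1}\widehat{\mathbb{RIF}}(\pi_j)\prod_{\substack{l=1\\ l\ne j}}^{k-1}\hat\pi_l-k\hat\Delta_k\prod_{j=1}^{k}\hat\pi_j-(k-1)\hat\eta_k\prod_{j=1}^{k-1}\hat\pi_j\Big].$$ Empty products equal $1$ and empty sums equal $0$.
   Context: Data and model. $O=(X,A,\overline{Z}_K,\overline{M}_K,Y)$ with $A,M_1,\dots,M_K\in\{0,1\}$, $Y$ real and square integrable, $X$ baseline covariates, $Z_k$ covariates realized before $M_k$ and after $M_{k-1}$; $\overline{Z}_k=(Z_1,\dots,Z_k)$, $\overline{M}_k=(M_1,\dots,M_k)$, $M_0\equiv A$. Monotonicity: $M_{k+1}=0$ whenever $M_k=0$. $\mathcal{P}$ is the otherwise unrestricted set of laws of $O$ satisfying positivity: for some $\epsilon>0$, $\Pr(A=a\mid X)>\epsilon$ and $\Pr(M_k=m\mid X,\overline{Z}_k,A=1,\overline{M}_{k-1}=\overline{1}_{k-1})>\epsilon$ for $a,m\in\{0,1\}$, $k=1,\dots,K$. Here $\overline{1}_k$ is the all-ones vector of length $k$. Nuisance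 functions. $\pi_{0a}(X)=\Pr(A=a\mid X)$, and $\pi_{km}(X,\overline{Z}_k)=\Pr(M_k=m\mid X,\overline{Z}_k,A=1,\overline{M}_{k-1}=\overline{1}_{k-1})$ for $k\ge1$ (these carry two indices and differ from the scalar parameters $\pi_k$ below). For $k\ge 1$, $m\in\{0,1\}$: $\mu^k_{km}(X,\overline{Z}_k)=\mathbb{E}[Y\mid X,\overline{Z}_k,A=1,\overline{M}_{k-1}=\overline{1}_{k-1},M_k=m]$ and, for $j=k-1,\dots,0$, $\mu^k_{jm}(X,\overline{Z}_j)=\mathbb{E}[\mu^k_{j+1,m}(X,\overline{Z}_{j+1})\mid X,\overline{Z}_j,A=1,\overline{M}_j=\overline{1}_j]$. For $k=0$: $\mu^0_{0a}(X)=\mathbb{E}[Y\mid X,A=a]$. For $k=0,\dots,K-1$: $\gamma^k_k(X,\overline{Z}_k)=\mathbb{E}[M_{k+1}\mid X,\overline{Z}_k,A=1,\overline{M}_k=\overline{1}_k]$ and, for $j=k-1,\dots,0$, $\gamma^k_j(X,\overline{Z}_j)=\mathbb{E}[\gamma^k_{j+1}(X,\overline{Z}_{j+1})\mid X,\overline{Z}_j,A=1,\overline{M}_j=\overline{1}_j]$. Functionals. $\psi_{km}=\mathbb{E}[\mu^k_{0m}(X)]$ for $k=0,\dots,K$; $\phi_k=\mathbb{E}[\gamma^k_0(X)]$ for $k=0,\dots,K-1$. Then - $\tau_k=\psi_{k1}-\psi_{k0}$ for $k=0,\dots,K$; - $\Delta_k=\psi_{k+1,0}-\psi_{k0}$ for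 $k=0,\dots,K-1$, and $\Delta_K=\tau_K$; - $\pi_k=\phi_{k-1}$ for $k=1,\dots,K$; - $\eta_k=\tau_{k-1}-\Delta_{k-1}-\pi_k\tau_k$ for $k=1,\dots,K$; - $\theta_k=\big(\prod_{j=1}^k\pi_j\big)\Delta_k+\big(\prod_{j=1}^{k-1}\pi_j\big)\eta_k$ for $k=1,\dots,K$, and $\theta_0=\Delta_0$. Known EIFs of the building blocks. For $k\ge1$, $$\mathbb{IF}(\psi_{km})=\mu^k_{0m}(X)-\psi_{km}+\sum_{j=1}^{k}\frac{A}{\pi_{01}}\Big(\prod_{l=1}^{j-1}\frac{M_l}{\pi_{l1}}\Big)\big(\mu^k_{jm}-\mu^k_{j-1,m}\big)+\frac{A}{\pi_{01}}\Big(\prod_{l=1}^{k-1}\frac{M_l}{\pi_{l1}}\Big)\frac{\mathbb{I}(M_k=m)}{\pi_{km}}\big(Y-\mu^k_{km}\big),$$ and $\mathbb{IF}(\psi_{0a})=\mu^0_{0a}(X)-\psi_{0a}+\frac{\mathbb{I}(A=a)}{\pi_{0a}}(Y-\mu^0_{0a})$. Also $$\mathbb{IF}(\phi_k)=\gamma^k_0(X)-\phi_k+\sum_{j=1}^{k}\frac{A}{\pi_{01}}\Big(\prod_{l=1}^{j-1}\frac{M_l}{\pi_{l1}}\Big)(\gamma^k_j-\gamma^k_{j-1})+\frac{A}{\pi_{01}}\Big(\prod_{l=1}^{k}\frac{M_l}{\pi_{l1}}\Big)(M_{k+1}-\gamma^k_k).$$ The EIFs of $\tau_k,\Delta_k,\pi_k$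 are the corresponding linear combinations. Estimators. $\mathbb{P}_n$ is the empirical mean. For a parameter $\phi$, $\mathbb{RIF}(\phi)=\mathbb{IF}(\phi)+\phi$ is the recentered EIF, and $\widehat{\mathbb{RIF}}(\phi)$ is $\mathbb{RIF}(\phi)$ with nuisance functions (and, for $\eta_k$, the parameters $\tau_k$ and $\pi_k$) replaced by estimates: in particular $\widehat{\mathbb{RIF}}(\eta_k)=\widehat{\mathbb{RIF}}(\tau_{k-1})-\widehat{\mathbb{RIF}}(\Delta_{k-1})-\hat\tau_k\widehat{\mathbb{RIF}}(\pi_k)-\hat\pi_k\widehat{\mathbb{RIF}}(\tau_k)+\hat\pi_k\hat\tau_k$. For $\phi\in\{\tau_k,\Delta_k,\pi_k\}$, $\hat\phi=\mathbb{P}_n[\widehat{\mathbb{RIF}}(\phi)]$, and $\hat\eta_k=\hat\eta_k^{\mathrm{eif}}$. The estimated EIFs of $\eta_k$ and $\theta_k$ are the displayed EIF formulas written in terms of recentered EIFs, with all quantities other than the centering constant $-\eta_k$ (respectively $-\theta_k$) replaced by estimates. *)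

(* Defs.v *)
From HB Require Import structures.
From mathcomp Require Import all_boot all_order all_algebra.
From mathcomp Require Import all_classical all_reals all_analysis.
From mathcomp Require Import ring.

Set Implicit Arguments.
Unset Strict Implicit.
Unset Printing Implicit Defensive.

Import Order.TTheory GRing.Theory Num.Theory.
Import numFieldNormedType.Exports.

Local Open Scope classical_set_scope.
Local Open Scope ring_scope.

Section conditional_expectation.
Context d (T : measurableType d) (R : realType).
Implicit Types (P : probability T R) (G : set (set T)) (E : set T).

(* [g] is a version of E_P[f | G, E]: it is determined P-almost surely on [E]
   only. *)
Definition is_cexp P G E (f g : T -> R) : Prop :=
  [/\ forall B : set R, measurable B -> G (g @^-1` B),
      P.-integrable E (EFin \o g)
    & forall B, G B ->
        (\int[P]_(o in B `&` E) (g o)%:E = \int[P]_(o in B `&` E) (f o)%:E)%E].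

Definition cexp P G E (f : T -> R) : T -> R :=
  xget (cst 0) [set g | is_cexp P G E f g].

End conditional_expectation.

Section efficient_influence_function.
Context d (T : measurableType d) (R : realType).
Implicit Types (P : probability T R) (Pt : R -> probability T R) (s : T -> R).

(* Differentiability in quadratic mean at 0 with score [s]: near 0, [p t] is a
   density of [Pt t] with respect to a common dominating measure. *)
Definition qmd Pt s : Prop :=
  exists (nu : {sigma_finite_measure set T -> \bar R}) (p : R -> T -> R),
    (\forall t \near (0 : R),
      [/\ measurable_fun setT (p t), forall o, 0 <= p t o
        & forall B, measurable B ->
            (Pt t B = \int[nu]_(o in B) (p t o)%:E)%E]) /\
    (fun t : R => (\int[nu]_o
       (((Num.sqrt (p t o) - Num.sqrt (p 0 o)) / t
          - s o * Num.sqrt (p 0 o) / 2) ^+ 2)%:E)%E) @ (0 : R)^' --> 0%E.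

(* One-dimensional submodels through P with score s.  The model is given by
   its strata [Q e C], the model itself being the union of the [Q e C] over
   e > 0 and C, and a regular submodel is required to stay locally in one
   stratum.  (Here e will be the positivity constant and C a bound on the
   second moment of the outcome; without such local uniformity no mean, nor
   any inverse probability weighted mean, is pathwise differentiable.) *)
Definition regular_submodel (Q : R -> R -> set (probability T R)) P Pt s :=
  [/\ Pt 0 = P,
      exists e C : R, 0 < e /\ \forall t \near (0 : R), Q e C (Pt t),
      s \in Lfun P 2%:E
    & qmd Pt s].

Definition is_score Q P s : Prop := exists Pt, regular_submodel Q P Pt s.

(* Closure in L^2(P) of the linear span of the scores. *)
Definition tangent_space Q P : set (T -> R) :=
  [set D | D \in Lfun P 2%:E /\
    forall e : R, 0 < e -> exists (n : nat) (c : 'I_n -> R) (s : 'I_n -> T -> R),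
      (forall i, is_score Q P (s i)) /\
      (\int[P]_o ((D o - \sum_(i < n) c i * s i o) ^+ 2)%:E <= e%:E)%E].

(* [D] represents the pathwise derivative of [psi] at P and lies in the tangent
   space; such a [D] is unique P-almost surely. *)
Definition is_EIF Q P (psi : probability T R -> R) (D : T -> R) : Prop :=
  tangent_space Q P D /\
  forall Pt s, regular_submodel Q P Pt s ->
    is_derive (0 : R) (1 : R) (fun t => psi (Pt t)) (\int[P]_o (D o * s o)).

End efficient_influence_function.

(* The cylinders of the product of the spaces of Z_1, ..., Z_K that depend on
   one of the first [k] coordinates (index [i] stands for Z_{i+1}). *)
Definition zcylinders (K : nat) (dZ : 'I_K -> measure_display)
    (TZ : forall i, measurableType (dZ i)) (k : nat) :
    set (set (forall i, TZ i)) :=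
  [set A | exists (i : 'I_K) (B : set (TZ i)),
     [/\ (i < k)%N, measurable B & A = [set z : forall i, TZ i | B (z i)]]].
Arguments zcylinders {K dZ} TZ k _.

(* The product of the spaces of Z_1, ..., Z_K, with the product sigma-algebra *)
Notation zspace K TZ := (g_sigma_algebraType (zcylinders TZ K)).

(* O = (X, A, (Z_1, ..., Z_K), (M_1, ..., M_K), Y) *)
Notation obs R K TX TZ :=
  (TX * bool * zspace K TZ * K.-tuple bool * measurableTypeR R)%type.

(* Values of nuisance functions at an observation:
     nu_pi k m  : pi_{km}     (pi_{0a} when k = 0)
     nu_mu k j m: mu^k_{jm}
     nu_gamma k j: gamma^k_j. *)
Record nuisance (T : Type) (R : realType) := Nuisance {
  nu_pi : nat -> bool -> T -> R;
  nu_mu : nat -> nat -> bool -> T -> R;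
  nu_gamma : nat -> nat -> T -> R }.

(* tau_k, Delta_k and pi_k as linear combinations of the psi_{km} and phi_k,
   applied alike to the functionals, their EIFs and their recentered EIFs. *)

Definition tau_of (R : realType) (psi : nat -> bool -> R) (k : nat) : R :=
  psi k true - psi k false.

Definition Delta_of (R : realType) (K : nat) (psi : nat -> bool -> R)
    (k : nat) : R :=
  if k == K then tau_of psi K else psi k.+1 false - psi k false.

Definition pi_of (R : realType) (phi : nat -> R) (k : nat) : R := phi k.-1.

Definition eta_grad (R : realType)
    (IFtau' IFDelta' IFpi IFtau tau pi : R) : R :=
  IFtau' - IFDelta' - tau * IFpi - pi * IFtau.

Definition theta_grad (R : realType) (k : nat) (IFDelta : R) (IFpi : nat -> R)
    (IFeta Delta eta : R) (pi : nat -> R) : R :=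
  IFDelta * \prod_(1 <= j < k.+1) pi j
  + Delta * \sum_(1 <= j < k.+1) IFpi j * \prod_(1 <= l < k.+1 | l != j) pi l
  + IFeta * \prod_(1 <= j < k) pi j
  + eta * \sum_(1 <= j < k) IFpi j * \prod_(1 <= l < k | l != j) pi l.

(* The same in terms of recentered EIFs, IF(phi) = RIF(phi) - phi, with the
   centering constant isolated: tau_{k-1} - Delta_{k-1} = eta_k + pi_k tau_k,
   and Delta_k prod_{j<=k} pi_j + eta_k prod_{j<k} pi_j = theta_k.  See
   [IF_etaE] and [IF_thetaE] below. *)
Definition eta_recentered (R : realType)
    (Rtau' RDelta' Rpi Rtau tau pi center : R) : R :=
  eta_grad Rtau' RDelta' (Rpi - pi) (Rtau - tau) tau pi
  - (center + pi * tau).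

Definition theta_recentered (R : realType) (k : nat) (RDelta : R)
    (Rpi : nat -> R) (Reta Delta eta : R) (pi : nat -> R) (center : R) : R :=
  theta_grad k RDelta (fun j => Rpi j - pi j) Reta Delta eta pi - center.

Section setting.
Context (R : realType) (K : nat) (dX : measure_display)
  (TX : measurableType dX) (dZ : 'I_K -> measure_display)
  (TZ : forall i, measurableType (dZ i)).

Local Notation O := (obs R K TX TZ).
Implicit Types (P : probability O R) (o : O) (k j : nat) (m : bool).

Definition Xc o : TX := o.1.1.1.1.
Definition Ac o : bool := o.1.1.1.2.
Definition Zc o : zspace K TZ := o.1.1.2.
Definition Yc o : R := o.2.

(* M_0 = A, and M_k is the k-th entry of the tuple for 1 <= k <= K. *)
Definition Mc k o : bool := nth false (Ac o :: o.1.2) k.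

(* sigma(X, Z_1, ..., Z_k) *)
Definition hist k : set (set O) :=
  <<s [set Xc @^-1` B | B in measurable] `|`
      [set Zc @^-1` B | B in zcylinders TZ k] >>.

(* [risk 0] is the sure event and [risk k.+1] is
   {A = 1, M_1 = ... = M_k = 1}. *)
Definition risk k : set O := [set o | forall j, (j < k)%N -> Mc j o].

Fixpoint iter_cexp P (f : O -> R) j (n : nat) : O -> R :=
  if n is n'.+1
  then cexp P (hist j) (risk j.+1) (iter_cexp P f j.+1 n')
  else f.

(* For k = 0 this is Pr(A = m | X). *)
Definition pi_fun P k m : O -> R :=
  cexp P (hist k) (risk k) (fun o => (Mc k o == m)%:R).

(* mu^k_{jm} for j <= k; for k = j = 0 this is E[Y | X, A = m]. *)
Definition mu_fun P k j m : O -> R :=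
  iter_cexp P
    (cexp P (hist k) (risk k `&` [set o | Mc k o = m]) Yc) j (k - j).

(* gamma^k_j for j <= k < K *)
Definition gamma_fun P k j : O -> R :=
  iter_cexp P
    (cexp P (hist k) (risk k.+1) (fun o => (Mc k.+1 o)%:R)) j (k - j).

Definition nuis P : nuisance O R :=
  Nuisance (pi_fun P) (mu_fun P) (gamma_fun P).

Definition stratum (e C : R) : set (probability O R) :=
  [set P : probability O R |
    [/\ {ae P, forall o k, (k < K)%N -> ~~ Mc k o -> ~~ Mc k.+1 o},
        (\int[P]_o (Yc o ^+ 2)%:E <= C%:E)%E
      & forall k m, (k <= K)%N ->
          {ae P, forall o, risk k o -> e < pi_fun P k m o}]].

Definition model : set (probability O R) :=
  [set P : probability O R | exists e C : R, 0 < e /\ stratum e C P].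

Definition EIF P (psi : probability O R -> R) (D : O -> R) : Prop :=
  is_EIF stratum P psi D.

Definition psi_ P k m : R := \int[P]_o mu_fun P k 0 m o.
Definition phi_ P k : R := \int[P]_o gamma_fun P k 0 o.

Definition tau_ P k : R := tau_of (psi_ P) k.
Definition Delta_ P k : R := Delta_of K (psi_ P) k.
Definition pi_ P k : R := pi_of (phi_ P) k.
Definition eta_ P k : R := tau_ P k.-1 - Delta_ P k.-1 - pi_ P k * tau_ P k.
Definition theta_ P k : R :=
  if k == 0%N then Delta_ P 0 else
  (\prod_(1 <= j < k.+1) pi_ P j) * Delta_ P k
  + (\prod_(1 <= j < k) pi_ P j) * eta_ P k.

(* (A / pi_{01}) prod_{l=1}^{j-1} M_l / pi_{l1}, an empty product if j = 0 *)
Definition ipw (nu : nuisance O R) j o : R :=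
  \prod_(0 <= l < j) ((Mc l o)%:R / nu_pi nu l true o).

(* For k = 0 the sum is empty and the last term is
   I(A = m) / pi_{0m} (Y - mu^0_{0m}). *)
Definition RIF_psi (nu : nuisance O R) k m o : R :=
  nu_mu nu k 0 m o
  + \sum_(1 <= j < k.+1) ipw nu j o * (nu_mu nu k j m o - nu_mu nu k j.-1 m o)
  + ipw nu k o * ((Mc k o == m)%:R / nu_pi nu k m o) *
      (Yc o - nu_mu nu k k m o).

Definition RIF_phi (nu : nuisance O R) k o : R :=
  nu_gamma nu k 0 o
  + \sum_(1 <= j < k.+1) ipw nu j o * (nu_gamma nu k j o - nu_gamma nu k j.-1 o)
  + ipw nu k.+1 o * ((Mc k.+1 o)%:R - nu_gamma nu k k o).

Definition RIF_tau (nu : nuisance O R) k o : R :=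
  tau_of (fun i m => RIF_psi nu i m o) k.
Definition RIF_Delta (nu : nuisance O R) k o : R :=
  Delta_of K (fun i m => RIF_psi nu i m o) k.
Definition RIF_pi (nu : nuisance O R) k o : R :=
  pi_of (fun i => RIF_phi nu i o) k.

(* [tau] and [pi] are the values used for tau_k and pi_k. *)
Definition RIF_eta (nu : nuisance O R) (tau pi : R) k o : R :=
  RIF_tau nu k.-1 o - RIF_Delta nu k.-1 o
  - tau * RIF_pi nu k o - pi * RIF_tau nu k o + pi * tau.

Definition IF_psi P k m o : R := RIF_psi (nuis P) k m o - psi_ P k m.
Definition IF_phi P k o : R := RIF_phi (nuis P) k o - phi_ P k.

Definition IF_tau P k o : R := tau_of (fun i m => IF_psi P i m o) k.
Definition IF_Delta P k o : R := Delta_of K (fun i m => IF_psi P i m o) k.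
Definition IF_pi P k o : R := pi_of (fun i => IF_phi P i o) k.

Definition IF_eta P k o : R :=
  eta_grad (IF_tau P k.-1 o) (IF_Delta P k.-1 o) (IF_pi P k o) (IF_tau P k o)
    (tau_ P k) (pi_ P k).

Definition IF_theta P k o : R :=
  theta_grad k (IF_Delta P k o) (IF_pi P ^~ o) (IF_eta P k o)
    (Delta_ P k) (eta_ P k) (pi_ P).

Lemma IF_tauE P k o : IF_tau P k o = RIF_tau (nuis P) k o - tau_ P k.
Proof. rewrite /IF_tau /RIF_tau /tau_ /tau_of /IF_psi; ring. Qed.

Lemma IF_DeltaE P k o : IF_Delta P k o = RIF_Delta (nuis P) k o - Delta_ P k.
Proof.
rewrite /IF_Delta /RIF_Delta /Delta_ /Delta_of /tau_of /IF_psi.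
by case: ifP => _; ring.
Qed.

Lemma IF_etaE P k o :
  IF_eta P k o =
  eta_recentered (RIF_tau (nuis P) k.-1 o) (RIF_Delta (nuis P) k.-1 o)
    (RIF_pi (nuis P) k o) (RIF_tau (nuis P) k o) (tau_ P k) (pi_ P k) (eta_ P k).
Proof.
rewrite /IF_eta !IF_tauE IF_DeltaE /eta_recentered /eta_grad /eta_.
rewrite /IF_pi /RIF_pi /pi_ /pi_of /IF_phi; ring.
Qed.

Lemma RIF_etaE P k o :
  RIF_eta (nuis P) (tau_ P k) (pi_ P k) k o = IF_eta P k o + eta_ P k.
Proof. rewrite IF_etaE /eta_recentered /eta_grad /RIF_eta; ring. Qed.

Lemma IF_thetaE P k o : (0 < k)%N ->
  IF_theta P k o =
  theta_recentered k (RIF_Delta (nuis P) k o) (RIF_pi (nuis P) ^~ o)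
    (RIF_eta (nuis P) (tau_ P k) (pi_ P k) k o) (Delta_ P k) (eta_ P k) (pi_ P)
    (theta_ P k).
Proof.
case: k => // k _.
rewrite /IF_theta /theta_recentered /theta_grad IF_DeltaE RIF_etaE /theta_ /=.
ring.
Qed.

Section estimators.
Context (n : nat) (data : 'I_n -> O) (nu : nuisance O R).

Definition Pn (f : O -> R) : R := (\sum_(i < n) f (data i)) / n%:R.

Definition tau_hat k : R := Pn (RIF_tau nu k).
Definition Delta_hat k : R := Pn (RIF_Delta nu k).
Definition pi_hat k : R := Pn (RIF_pi nu k).
Definition RIF_eta_hat k o : R := RIF_eta nu (tau_hat k) (pi_hat k) k o.
Definition eta_hat k : R := Pn (RIF_eta_hat k).

(* Estimated EIFs: everything is replaced by estimates except the centering
   constant [c], standing for eta_k, respectively theta_k. *)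
Definition est_IF_eta k (c : R) o : R :=
  eta_recentered (RIF_tau nu k.-1 o) (RIF_Delta nu k.-1 o) (RIF_pi nu k o)
    (RIF_tau nu k o) (tau_hat k) (pi_hat k) c.

Definition est_IF_theta k (c : R) o : R :=
  theta_recentered k (RIF_Delta nu k o) (RIF_pi nu ^~ o) (RIF_eta_hat k o)
    (Delta_hat k) (eta_hat k) pi_hat c.

End estimators.

End setting.

(* Main.v *)
(* The pathwise derivative is linear and obeys the Leibniz rule, and the tangent
   space is a linear subspace of L^2(P); hence the efficient influence functions
   of sums, multiples and products of functionals follow the rules of
   differential calculus.  Since eta_k and theta_k are polynomials in the
   building blocks, their EIFs are obtained by formal differentiation.  The
   estimating equations are affine in the centering constant. *)
Require Import Defs.
From HB Require Import structures.
From mathcomp Require Import all_boot all_order all_algebra.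
From mathcomp Require Import all_classical all_reals all_analysis.
From mathcomp Require Import measurable_realfun ring lra.

Set Implicit Arguments.
Unset Strict Implicit.
Unset Printing Implicit Defensive.

Import Order.TTheory GRing.Theory Num.Theory.
Import numFieldNormedType.Exports.

Local Open Scope classical_set_scope.
Local Open Scope ring_scope.

(** * Linear combinations and pairings of square-integrable functions *)

Section L2.
Context d (T : measurableType d) (R : realType) (P : probability T R).
Implicit Types f g : T -> R.

Lemma Lfun2_lincomb2 a b f g : f \in Lfun P 2%:E -> g \in Lfun P 2%:E ->
  (fun o => a * f o + b * g o) \in Lfun P 2%:E.
Proof.
have p1 : (1 <= 2%:E :> \bar R)%E by rewrite lee_fin ler1n.
have [L0 LL] := Lfun_submod_closed P p1.
move=> fL gL; have -> : (fun o => a * f o + b * g o) = a *: f + (b *: g + 0).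
  by apply/funext => o; rewrite !fctE /= addr0.
by apply: (LL) => //; apply: LL.
Qed.

Lemma Lfun2_sum (n : nat) (c : 'I_n -> R) (s : 'I_n -> T -> R) :
  (forall i, s i \in Lfun P 2%:E) ->
  (fun o => \sum_(i < n) c i * s i o) \in Lfun P 2%:E.
Proof.
have p1 : (1 <= 2%:E :> \bar R)%E by rewrite lee_fin ler1n.
have [L0 _] := Lfun_submod_closed P p1.
elim: n c s => [|n IH] c s sL.
  by under [X in X \in _]funext => o do rewrite big_ord0.
under [X in X \in _]funext => o do rewrite big_ord_recl -[X in _ + X]mul1r.
exact: Lfun2_lincomb2 (IH _ _ _).
Qed.

Lemma measurable_Lfun f p : f \in Lfun P p -> measurable_fun setT f.
Proof. by move=> /sub_Lfun_mfun; rewrite inE. Qed.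

(** Products of two L^2 functions are in L^1, so the integral splits. This carries linear
    combinations of gradients over to pathwise derivatives. *)
Lemma Rintegral_mul_lincomb2 a b f g s : f \in Lfun P 2%:E ->
  g \in Lfun P 2%:E -> s \in Lfun P 2%:E ->
  \int[P]_o ((a * f o + b * g o) * s o) =
  a * \int[P]_o (f o * s o) + b * \int[P]_o (g o * s o).
Proof.
move=> fL gL sL.
have fsL := Lfun2_mul_Lfun1 fL sL; have gsL := Lfun2_mul_Lfun1 gL sL.
have ifs := (Lfun1_integrable _ _).1 fsL.
have igs := (Lfun1_integrable _ _).1 gsL.
under eq_Rintegral do rewrite mulrDl -!mulrA.
rewrite RintegralD //; first by rewrite !RintegralZl.
- by apply: (integrableZl measurableT a ifs).
- by apply: (integrableZl measurableT b igs).
Qed.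

(** Integrated form of (x + y)^2 <= 2 x^2 + 2 y^2; it replaces the triangle inequality when adding
    approximation errors. The integrals may be infinite. *)
Lemma le_integral_sqr_lincomb2 a b f g : measurable_fun setT f ->
  measurable_fun setT g ->
  (\int[P]_o ((a * f o + b * g o) ^+ 2)%:E <=
   (2 * a ^+ 2)%:E * \int[P]_o (f o ^+ 2)%:E
   + (2 * b ^+ 2)%:E * \int[P]_o (g o ^+ 2)%:E)%E.
Proof.
move=> mf mg.
have msq (h : T -> R) : measurable_fun setT h ->
    measurable_fun setT (fun o => (h o ^+ 2)%:E).
  by move=> mh; apply/measurable_EFinP/measurable_funX.
have mZ (c : R) (h : T -> R) : measurable_fun setT h ->
    measurable_fun setT (fun o => c%:E * (h o ^+ 2)%:E)%E.
  by move=> mh; apply: measurable_funeM; exact: msq.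
have sq0 (h : T -> R) o : (0 <= (h o ^+ 2)%:E)%E by rewrite lee_fin sqr_ge0.
have two0 (c : R) : 0 <= 2 * c ^+ 2 by rewrite mulr_ge0 ?sqr_ge0.
have sq20 (c : R) (h : T -> R) o : (0 <= (2 * c ^+ 2)%:E * (h o ^+ 2)%:E)%E.
  by rewrite mule_ge0 // lee_fin.
have mla : measurable_fun setT (fun o => a * f o + b * g o).
  by apply: measurable_funD; apply: measurable_funM.
rewrite -!ge0_integralZl_EFin ?two0 //; [|exact: msq..].
rewrite -ge0_integralD //; [|exact: mZ..].
apply: ge0_le_integral => //.
- by move=> o _; rewrite lee_fin sqr_ge0.
- exact: msq.
- by apply: emeasurable_funD; exact: mZ.
- move=> o _; rewrite -!EFinM -EFinD lee_fin.
  (* The gap between the two sides is exactly this square. *)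
  by have := sqr_ge0 (a * f o - b * g o); nra.
Qed.
End L2.

(** * Differential calculus of efficient influence functions *)

Section EIF_calculus.
Context d (T : measurableType d) (R : realType).
Variables (Q : R -> R -> set (probability T R)) (P : probability T R).
Implicit Types (psi : probability T R -> R) (D s : T -> R) (a b c : R).

Lemma tangent_space0 : tangent_space Q P (cst 0).
Proof.
split=> [|e e0]; first exact: Lfun_cst.
exists 0%N, (fun=> 0), (fun=> cst 0); split; first by case.
by under eq_integral do rewrite big_ord0 subr0 expr0n; rewrite integral0 lee_fin ltW.
Qed.

(** Approximate [D1] and [D2] separately by combinations of scores, then concatenate the two
    families. *)
Lemma tangent_space_lincomb2 a b D1 D2 :
  tangent_space Q P D1 -> tangent_space Q P D2 ->
  tangent_space Q P (fun o => a * D1 o + b * D2 o).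
Proof.
move=> [L1 H1] [L2 H2]; split=> [|e e0]; first exact: Lfun2_lincomb2.
(* This tolerance makes 2 r^2 times the error at most e / 2; the added 1 keeps the denominator
   positive when r = 0. *)
have pos r : 0 < e / (4 * (r ^+ 2 + 1)).
  by rewrite divr_gt0 // mulr_gt0 // ltr_wpDl ?sqr_ge0.
have [n1 [c1 [s1 [S1 I1]]]] := H1 _ (pos a).
have [n2 [c2 [s2 [S2 I2]]]] := H2 _ (pos b).
have scoreL s : is_score Q P s -> s \in Lfun P 2%:E by case=> Pt [].
have residualL n (c : 'I_n -> R) (s : 'I_n -> T -> R) D :
    D \in Lfun P 2%:E -> (forall i, is_score Q P (s i)) ->
    measurable_fun setT (fun o => D o - \sum_(i < n) c i * s i o).
  move=> /measurable_Lfun mD Ss; apply: measurable_funB => //.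
  by apply: (measurable_Lfun (p := 2%:E)); apply: Lfun2_sum => i; exact: scoreL.
(* The first [n1] indices carry the approximation of [D1] scaled by [a], the last [n2] that of [D2]
   scaled by [b]. *)
pose c (i : 'I_(n1 + n2)) :=
  match fintype.split i with inl j => a * c1 j | inr j => b * c2 j end.
pose s (i : 'I_(n1 + n2)) :=
  match fintype.split i with inl j => s1 j | inr j => s2 j end.
exists (n1 + n2)%N, c, s; split.
  by move=> i; rewrite /s; case: fintype.split.
have -> : (\int[P]_o
    ((a * D1 o + b * D2 o - \sum_(i < n1 + n2) c i * s i o) ^+ 2)%:E =
  \int[P]_o
    ((a * (D1 o - \sum_(i < n1) c1 i * s1 i o)
      + b * (D2 o - \sum_(i < n2) c2 i * s2 i o)) ^+ 2)%:E)%E.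
  apply: eq_integral => o _; congr (_ ^+ 2)%:E.
  rewrite big_split_ord /= !mulrBr opprD addrACA; congr (_ - _ + (_ - _)).
    rewrite mulr_sumr; apply: eq_bigr => i _.
    by rewrite /c /s (unsplitK (inl i)) mulrA.
  rewrite mulr_sumr; apply: eq_bigr => i _.
  by rewrite /c /s (unsplitK (inr i)) mulrA.
apply: le_trans; first by apply: le_integral_sqr_lincomb2; exact: residualL.
have half r : 2 * r ^+ 2 * (e / (4 * (r ^+ 2 + 1))) <= e / 2.
  have r1 : 0 < r ^+ 2 + 1 by rewrite ltr_wpDl ?sqr_ge0.
  have -> : 2 * r ^+ 2 * (e / (4 * (r ^+ 2 + 1))) =
      e / 2 * (r ^+ 2 / (r ^+ 2 + 1)) by field; rewrite gt_eqF.
  by rewrite ger_pMr ?divr_gt0 // ler_pdivrMr // mul1r lerDl.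
have -> : e = e / 2 + e / 2 by field.
rewrite EFinD; apply: leeD.
  apply: le_trans (lee_wpmul2l _ I1) _; first by rewrite lee_fin mulr_ge0 ?sqr_ge0.
  by rewrite -EFinM lee_fin half.
apply: le_trans (lee_wpmul2l _ I2) _; first by rewrite lee_fin mulr_ge0 ?sqr_ge0.
by rewrite -EFinM lee_fin half.
Qed.

(** Base case for products: the empty product is the constant 1. *)
Lemma is_EIF_cst c : is_EIF Q P (fun=> c) (cst 0).
Proof.
split=> [|Pt s _]; first exact: tangent_space0.
have -> : \int[P]_o (cst 0 o * s o) = 0.
  under eq_Rintegral do rewrite mul0r.
  by rewrite Rintegral_cst // mul0r.
exact: is_derive_cst.
Qed.

Lemma is_EIF_lincomb2 a b psi1 psi2 D1 D2 :
  is_EIF Q P psi1 D1 -> is_EIF Q P psi2 D2 ->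
  is_EIF Q P (fun P' => a * psi1 P' + b * psi2 P')
    (fun o => a * D1 o + b * D2 o).
Proof.
move=> [T1 H1] [T2 H2]; split=> [|Pt s Pts]; first exact: tangent_space_lincomb2.
have [_ _ sL _] := Pts.
rewrite (Rintegral_mul_lincomb2 _ _ T1.1 T2.1 sL).
exact: is_deriveD (is_deriveZ a (H1 _ _ Pts)) (is_deriveZ b (H2 _ _ Pts)).
Qed.

Lemma is_EIF_mul psi1 psi2 D1 D2 :
  is_EIF Q P psi1 D1 -> is_EIF Q P psi2 D2 ->
  is_EIF Q P (fun P' => psi1 P' * psi2 P')
    (fun o => psi1 P * D2 o + psi2 P * D1 o).
Proof.
move=> [T1 H1] [T2 H2]; split=> [|Pt s Pts]; first exact: tangent_space_lincomb2.
have [P0 _ sL _] := Pts.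
rewrite (Rintegral_mul_lincomb2 _ _ T2.1 T1.1 sL) -P0.
(* The Leibniz rule evaluates the factors at [Pt 0], which is [P]. *)
have H := is_deriveM (H1 _ _ Pts) (H2 _ _ Pts).
by rewrite P0 in H *; exact: H.
Qed.

Lemma is_EIF_ext psi1 psi2 D1 D2 : psi1 =1 psi2 -> D1 =1 D2 ->
  is_EIF Q P psi1 D1 -> is_EIF Q P psi2 D2.
Proof. by move=> /funext -> /funext ->. Qed.

(** Induction on [r] with the Leibniz rule. Uniqueness of the indices ensures that the filter
    [l != i] removes exactly one factor. *)
Lemma is_EIF_prod (I : eqType) (r : seq I) (psi : I -> probability T R -> R)
    (D : I -> T -> R) : uniq r ->
  (forall i, i \in r -> is_EIF Q P (psi i) (D i)) ->
  is_EIF Q P (fun P' => \prod_(i <- r) psi i P')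
    (fun o => \sum_(i <- r) D i o * \prod_(l <- r | l != i) psi l P).
Proof.
elim: r => [_ _|x r IH /= /andP[xr ur] H].
  by apply: is_EIF_ext (is_EIF_cst 1) => ?; rewrite big_nil.
have Hx := H _ (mem_head _ _).
have Hr : forall i, i \in r -> is_EIF Q P (psi i) (D i).
  by move=> i ir; apply: H; rewrite inE ir orbT.
apply: is_EIF_ext (is_EIF_mul Hx (IH ur Hr)) => [P'|o]; rewrite big_cons //.
rewrite addrC; congr (_ + _).
  (* Term of the head [x]: as [x] is not in [r], the filter leaves the product over [r] intact. *)
  rewrite big_cons eqxx /= mulrC; congr (_ * _).
  rewrite big_seq [RHS]big_seq_cond; apply: eq_bigl => l.
  by case: (boolP (l \in r)) => //= lr; symmetry; apply: contraNneq xr => <-.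
(* Terms of the tail: [i] differs from [x], so the factor at [x] survives the filter. *)
rewrite mulr_sumr; apply: eq_big_seq => i ir.
rewrite big_cons; case: eqP => [xi|_]; first by rewrite xi ir in xr.
by rewrite mulrCA.
Qed.

End EIF_calculus.

(** * Estimating equations for empirical means *)

Section empirical_mean.
Context (R : realType) (K : nat) (dX : measure_display)
  (TX : measurableType dX) (dZ : 'I_K -> measure_display)
  (TZ : forall i, measurableType (dZ i)) (n : nat)
  (data : 'I_n -> obs R K TX TZ).

(** On a nonempty sample the mean of a constant is that constant, so the equation is affine in [c]
    with slope -1. *)
Lemma Pn_center_eq0 (f g : obs R K TX TZ -> R) (c : R) : (0 < n)%N ->
  (forall o, f o = g o - c) -> Pn data f = 0 <-> c = Pn data g.
Proof.
move=> n0 fE; have nz : n%:R != 0 :> R by rewrite pnatr_eq0 -lt0n.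
have -> : Pn data f = Pn data g - c.
  rewrite /Pn; under eq_bigr do rewrite fE.
  rewrite sumrB sumr_const card_ord mulrBl -[c *+ n]mulr_natr mulfK //.
by split=> [/eqP|->]; rewrite ?subrr // subr_eq0 => /eqP.
Qed.

End empirical_mean.

(** Each subtracted [p j] restores the factor missing from its product, so every one of the [m.-1]
    terms gives back one full product. This is the source of the corrections by k and k - 1 in the
    estimator of theta_k. *)
Lemma sum_subr_mul_prod_neq (R : comRingType) (p D : nat -> R) (m : nat) :
  \sum_(1 <= j < m) (D j - p j) * \prod_(1 <= l < m | l != j) p l =
  \sum_(1 <= j < m) D j * \prod_(1 <= l < m | l != j) p l
  - m.-1%:R * \prod_(1 <= j < m) p j.
Proof.
have E j : j \in index_iota 1 m ->
    (D j - p j) * \prod_(1 <= l < m | l != j) p l =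
    D j * \prod_(1 <= l < m | l != j) p l - \prod_(1 <= l < m) p l.
  by move=> jm; rewrite mulrBl [in RHS](bigD1_seq j) ?iota_uniq.
by rewrite (eq_big_seq _ E) sumrB sumr_const_nat subn1 mulr_natl.
Qed.

(** * EIFs of eta_k and theta_k, and their estimators *)

Theorem theorem3p1 (R : realType) (K : nat) (dX : measure_display)
    (TX : measurableType dX) (dZ : 'I_K -> measure_display)
    (TZ : forall i, measurableType (dZ i)) (hK : (1 <= K)%N)
    (P : probability (obs R K TX TZ) R) (hP : model P)
    (* the known EIFs of the building blocks *)
    (hpsi : forall (k : nat) (m : bool), (k <= K)%N ->
      EIF P (fun Q => psi_ Q k m) (IF_psi P k m))
    (hphi : forall k : nat, (k < K)%N ->
      EIF P (fun Q => phi_ Q k) (IF_phi P k))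
    (* sample and estimated nuisance functions *)
    (n : nat) (hn : (0 < n)%N) (data : 'I_n -> obs R K TX TZ)
    (nu : nuisance (obs R K TX TZ) R)
    (k : nat) (hk : (1 <= k <= K)%N) :
  [/\ EIF P (fun Q => eta_ Q k)
        (fun o => IF_tau P k.-1 o - IF_Delta P k.-1 o
                  - tau_ P k * IF_pi P k o - pi_ P k * IF_tau P k o),
      EIF P (fun Q => theta_ Q k)
        (fun o =>
          IF_Delta P k o * \prod_(1 <= j < k.+1) pi_ P j
          + Delta_ P k * \sum_(1 <= j < k.+1)
              IF_pi P j o * \prod_(1 <= l < k.+1 | l != j) pi_ P l
          + IF_eta P k o * \prod_(1 <= j < k) pi_ P j
          + eta_ P k * \sum_(1 <= j < k)
              IF_pi P j o * \prod_(1 <= l < k | l != j) pi_ P l),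
      forall c : R,
        Pn data (est_IF_eta data nu k c) = 0 <->
        c = Pn data (fun o =>
          RIF_tau nu k.-1 o - RIF_Delta nu k.-1 o
          - tau_hat data nu k * RIF_pi nu k o
          - pi_hat data nu k * RIF_tau nu k o
          + pi_hat data nu k * tau_hat data nu k)
    & forall c : R,
        Pn data (est_IF_theta data nu k c) = 0 <->
        c = Pn data (fun o =>
          RIF_Delta nu k o * \prod_(1 <= j < k.+1) pi_hat data nu j
          + Delta_hat data nu k * \sum_(1 <= j < k.+1)
              RIF_pi nu j o *
              \prod_(1 <= l < k.+1 | l != j) pi_hat data nu l
          + RIF_eta_hat data nu k o * \prod_(1 <= j < k) pi_hat data nu j
          + eta_hat data nu k * \sum_(1 <= j < k)
              RIF_pi nu j o * \prod_(1 <= l < k | l != j) pi_hat data nu l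
          - k%:R * Delta_hat data nu k * \prod_(1 <= j < k.+1) pi_hat data nu j
          - k.-1%:R * eta_hat data nu k *
              \prod_(1 <= j < k) pi_hat data nu j)].
Proof.
have /andP[k0 kK] := hk.
have Hsub psi1 psi2 D1 D2 : EIF P psi1 D1 -> EIF P psi2 D2 ->
    EIF P (fun Q => psi1 Q - psi2 Q) (fun o => D1 o - D2 o).
  move=> H1 H2; apply: is_EIF_ext (is_EIF_lincomb2 1 (-1) H1 H2) => ?;
  by rewrite mul1r mulN1r.
have Htau m : (m <= K)%N -> EIF P (fun Q => tau_ Q m) (IF_tau P m).
  by move=> mK; apply: Hsub; exact: hpsi.
have HDelta m : (m <= K)%N -> EIF P (fun Q => Delta_ Q m) (IF_Delta P m).
  (* At m = K the convention Delta_K = tau_K applies; below K, the index m + 1 is still within the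
     range of [hpsi]. *)
  rewrite leq_eqVlt /Delta_ /IF_Delta /Delta_of => /predU1P[->|mK].
    by rewrite eqxx; exact: Htau.
  by rewrite ltn_eqF //; apply: Hsub; apply: hpsi => //; exact: ltnW.
have Hpi m : (0 < m <= K)%N -> EIF P (fun Q => pi_ Q m) (IF_pi P m).
  by case: m => // m mK; exact: hphi.
have Heta : EIF P (fun Q => eta_ Q k) (IF_eta P k).
  have k1K : (k.-1 <= K)%N by rewrite (leq_trans (leq_pred k)).
  have Hl := Hsub _ _ _ _ (Htau _ k1K) (HDelta _ k1K).
  have Hr := is_EIF_mul (Hpi _ hk) (Htau _ kK).
  apply: is_EIF_ext (Hsub _ _ _ _ Hl Hr) => // o.
  by rewrite /IF_eta /eta_grad opprD addrA addrAC.
(* Needed at m = k and at m = k - 1, the two products in theta_k. *)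
have Hprod m : (m <= k)%N ->
    EIF P (fun Q => \prod_(1 <= j < m.+1) pi_ Q j)
      (fun o => \sum_(1 <= j < m.+1)
         IF_pi P j o * \prod_(1 <= l < m.+1 | l != j) pi_ P l).
  move=> mk; apply: is_EIF_prod => [|j]; first exact: iota_uniq.
  rewrite mem_index_iota ltnS => /andP[j0 jm]; apply: Hpi.
  by rewrite j0 (leq_trans jm) // (leq_trans mk).
split.
- exact: Heta.
- have Hl := is_EIF_mul (Hprod _ (leqnn k)) (HDelta _ kK).
  have := Hprod _ (leq_pred k); rewrite (prednK k0) => Hp.
  have Hr := is_EIF_mul Hp Heta.
  apply: is_EIF_ext (is_EIF_lincomb2 1 1 Hl Hr) => [Q|o].
    by rewrite /theta_ gtn_eqF // !mul1r.
  by rewrite !mul1r addrA; congr (_ + _ + _ + _); rewrite mulrC.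
(* The equivalence gives both existence and uniqueness of the root. Recentering yields 2 pi tau, of
   which the centering term takes back one. *)
- move=> c; apply: Pn_center_eq0 => // o.
  rewrite /est_IF_eta /eta_recentered /eta_grad; ring.
- move=> c; apply: Pn_center_eq0 => // o.
  (* The sum multiplying the estimate of Delta_k has k terms, the one multiplying that of eta_k has
     k - 1. *)
  rewrite /est_IF_theta /theta_recentered /theta_grad !sum_subr_mul_prod_neq /=; ring.
Qed.
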